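(* Consider the heterogeneous $k$-server queue. Assume: (i) $\mathbb{P}(T_i>0)>0$ for all $i\in\overline{K}$, and moreover $F_0(0)=\mathbb{P}(T_0=0)=0$; (ii) the Markov process $X(\cdot)=\{(L(t),J(t),\boldsymbol{R}(t));t\ge 0\}$ has a stationary distribution; (iii) for every $i\in K$ the distribution $F_i$ is spread-out; and $\lambda_0<\sum_{i\in K}\lambda_i$. Let $K_0=\{i\in K:\beta_i=0\}$ be the index set of servers with heavy tailed service time distributions. Then, with $\alpha=\alpha_K$, $$\alpha=\alpha_{K\setminus K_0},$$ and $\alpha>0$ if and only if $\rho_{K\setminus K_0}<1$.
   Context: Model. Fix an integer $k\ge1$, $K=\{1,\dots,k\}$, $\overline{K}=\{0\}\cup K$. Customers arrive according to a renewal process with i.i.d. inter-arrival times of distribution $F_0$ with finite positive mean $1/\lambda_0$, join a single waiting line, and are served in first-come first-served order by $k$ servers; server $i\in K$ has i.i.d. service times with distribution $F_i$ of finite positive mean $1/\lambda_i$. All these sequences are independent. $T_i$ denotes a random variable with distribution $F_i$, $i\in\overline{K}$. No server idles while customers wait; when waiting customers are fewer than available servers, the servers starting service are chosen by a (possibly random) rule $D(A,j)\subset A$ depending only on the set $A$ of available servers and the number $j$ of waiting customers, with independent randomization. State process. $L(t)$ is the number of customers in system, $J(t)\subset K$ the set of busy servers, and $\boldsymbol{R}(t)=(R_0(t),\dots,R_k(t))$, where $R_0(t)$ is the residual time to the next arrival, $R_i(t)$ is the residual service time at server $i\in J(t)$ and $R_i(t)=0$ for $i\in K\setminus J(t)$.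 A distribution on $[0,\infty)$ is spread-out if for some $n\ge1$ its $n$-fold convolution has a nonzero absolutely continuous component with respect to Lebesgue measure. Functions. For $\theta\ge0$, $\eta(\theta)$ is the solution $\eta$ of $e^{\theta}\,\mathbb{E}(e^{\eta T_0})=1$. For $i\in K$, $\theta\ge0$, $0<v<\infty$, $\zeta_i(v,\theta)$ is the solution $\zeta$ of $e^{-\theta}\,\mathbb{E}(e^{\zeta (T_i\wedge v)})=1$ (where $a\wedge b=\min(a,b)$), and $\zeta_i(\vartriangle,\theta)=\lim_{v\uparrow\infty}\zeta_i(v,\theta)$ (a finite limit). Let $\beta_i=\sup\{\theta\in\mathbb{R}:\mathbb{E}(e^{\theta T_i})<\infty\}$. For $A\subset K$ define $$\rho_A=\frac{\lambda_0}{\sum_{i\in A}\lambda_i},\qquad \alpha_A=\sup\Big\{\theta\ge0:\ -\Big(\eta(\theta)+\sum_{i\in A}\zeta_i(\vartriangle,\theta)\Big)\le0\Big\},$$ with the convention $\rho_\emptyset=+\infty$. *)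

(* Defs.v *)
From HB Require Import structures.
From mathcomp Require Import all_boot all_order all_algebra.
From mathcomp Require Import all_classical all_reals all_analysis.

Set Implicit Arguments.
Unset Strict Implicit.
Unset Printing Implicit Defensive.

Import Order.TTheory GRing.Theory Num.Theory.
Import numFieldNormedType.Exports.

Local Open Scope classical_set_scope.
Local Open Scope ring_scope.

(* Distributions of nonnegative times are probability measures on the Borel
   line; being carried by [0, +oo[ is a hypothesis of the theorem. *)

Section distributions.
Context {R : realType}.
Implicit Types (F : probability R R) (z v th : R).

(* E(e^(z T)), an extended real, for T of distribution F *)
Definition exp_moment F z : \bar R := (\int[F]_x (expR (z * x))%:E)%E.

(* E(e^(z (T /\ v))) *)
Definition trunc_exp_moment F v z : \bar R :=
  (\int[F]_x (expR (z * Num.min x v))%:E)%E.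

(* "The solution of" an equation is a chosen solution, with value 0 if there
   is none. *)
Definition eta F th : R :=
  xget 0 [set z | ((expR th)%:E * exp_moment F z = 1)%E].

Definition zeta F v th : R :=
  xget 0 [set z | ((expR (- th))%:E * trunc_exp_moment F v z = 1)%E].

Definition zeta_lim F th : R := lim (zeta F v th @[v --> +oo%R]).

Definition exp_abscissa F : \bar R :=
  ereal_sup [set th%:E | th in [set th : R | (exp_moment F th < +oo)%E]].

(* n-fold convolution, by (F * G)(A) = \int F(dx) G(A - x) *)
Fixpoint conv_pow F (n : nat) : set R -> \bar R :=
  if n is m.+1 then
    fun A => (\int[F]_x conv_pow F m [set y | A (x + y)%R])%E
  else \d_(0 : R).

(* The Lebesgue decomposition ac + sg of a convolution power has a nonzero
   absolutely continuous component ac. *)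
Definition spread_out F : Prop :=
  exists2 n, (0 < n)%N &
  exists ac sg : {measure set (measurableTypeR R) -> \bar R},
  [/\ forall A : set (measurableTypeR R), measurable A ->
        conv_pow F n A = (ac A + sg A)%E,
      ac `<< lebesgue_measure,
      exists N : set (measurableTypeR R),
        [/\ measurable N, lebesgue_measure N = 0%E & sg (~` N) = 0%E]
    & ac setT != 0%E].

End distributions.

Section rates.
Context {R : realType} {k : nat}.
Variables (F0 : probability R R) (F : 'I_k -> probability R R).
Variables (lam0 : R) (lam : 'I_k -> R).
Implicit Type A : {set 'I_k}.

Definition heavy_tailed : {set 'I_k} :=
  [set i | exp_abscissa (F i) == 0%E]%SET.

Definition rho A : \bar R :=
  if A == finset.set0 then +oo%E else (lam0 / \sum_(i in A) lam i)%:E.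

(* The supremum may be +oo. *)
Definition alpha A : \bar R :=
  ereal_sup [set th%:E | th in
    [set th : R | 0 <= th /\
       - (eta F0 th + \sum_(i in A) zeta_lim (F i) th) <= 0]].

End rates.

(* The finite type {set T} carries its discrete sigma-algebra. *)
HB.instance Definition _ (T : finType) :=
  isPointed.Build {set T} finset.set0.
HB.instance Definition _ (T : finType) :=
  @isMeasurable.Build default_measure_display {set T} discrete_measurable
    discrete_measurable0 discrete_measurableC discrete_measurableU.

Section queue.
Context {R : realType} {k : nat}.

(* (L, J, (R_0, ..., R_k)); server i : 'I_k is the coordinate lift ord0 i of
   the vector of residual times. *)
Definition state : Type := (nat * {set 'I_k} * (k.+1).-tuple R)%type.

HB.instance Definition _ := Measurable.copy state
  (nat * {set 'I_k} * (k.+1).-tuple R)%type.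

Definition in_system (x : state) : nat := x.1.1.
Definition busy (x : state) : {set 'I_k} := x.1.2.
Definition res_arrival (x : state) : R := tnth x.2 ord0.
Definition res_service (x : state) (i : 'I_k) : R := tnth x.2 (lift ord0 i).

Definition mk_state (l : nat) (J : {set 'I_k}) (r0 : R) (r : 'I_k -> R) :
  state := (l, J, [tuple of r0 :: [tuple r i | i < k]]).

(* No server idles while customers wait, hence the size of J. *)
Definition valid_state (x : state) : Prop :=
  [/\ #|busy x| = minn (in_system x) k,
      0 <= res_arrival x,
      forall i, i \in busy x -> 0 <= res_service x i
    & forall i, i \notin busy x -> res_service x i = 0].

(* D A j B is the probability that B is chosen when A is the set of available
   servers and j customers wait. If j >= #|A| then B = A is forced. *)
Definition dispatch_rule (D : {set 'I_k} -> nat -> {set 'I_k} -> R) : Prop :=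
  forall A j,
    [/\ forall B, 0 <= D A j B,
        \sum_(B : {set 'I_k}) D A j B = 1
      & forall B, D A j B != 0 -> B \subset A /\ #|B| = minn #|A| j].

(* The inputs of one sample path: interarrival n and service i n are the
   n-th fresh interarrival time and the n-th fresh service time at server i
   (those in progress at time 0 belong to the initial state), and dispatch n A j
   is the choice made at the n-th event if A is then the set of available
   servers and j the number of waiting customers. *)
Record inputs := Inputs {
  interarrival : nat -> R;
  service : 'I_k -> nat -> R;
  dispatch : nat -> {set 'I_k} -> nat -> {set 'I_k} }.

(* The state just after an event, its epoch, and the numbers of fresh
   interarrival and service times already used. *)
Record config := Config {
  cstate : state;
  epoch : R;
  used_arrival : nat;
  used_service : 'I_k -> nat }.

Definition time_to_event (x : state) : R :=
  \big[Num.min/res_arrival x]_(i in busy x) res_service x i.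

(* All completions and the possible arrival occurring at the same epoch are
   treated simultaneously. A service of duration 0 completes in a later event
   of the same epoch. *)
Definition next_config (u : inputs) (n : nat) (c : config) : config :=
  let x := cstate c in
  let h := time_to_event x in
  let arrives := res_arrival x == h in
  let stay := [set i in busy x | res_service x i != h]%SET in
  let l := (in_system x - #|busy x :\: stay| + arrives)%N in
  let start := dispatch u n (~: stay)%SET (l - #|stay|)%N in
  Config
    (mk_state l (stay :|: start)
       (if arrives then interarrival u (used_arrival c)
        else res_arrival x - h)
       (fun i => if i \in start then service u i (used_service c i)
                 else if i \in stay then res_service x i - h else 0))
    (epoch c + h)
    (used_arrival c + arrives)%N
    (fun i => (used_service c i + (i \in start))%N).

Fixpoint config_at (u : inputs) (x0 : state) (n : nat) : config :=
  if n is m.+1 then next_config u m (config_at u x0 m)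
  else Config x0 0 0%N (fun _ => 0%N).

Definition elapse (h : R) (x : state) : state :=
  mk_state (in_system x) (busy x) (res_arrival x - h)
    (fun i => if i \in busy x then res_service x i - h else 0).

(* The right-continuous sample path t |-> (L(t), J(t), R(t)): the last event
   up to time t is the n-th one. *)
Definition queue_path (u : inputs) (x0 : state) (t : R) : state :=
  let n := xget 0%N [set n | epoch (config_at u x0 n) <= t
                           < epoch (config_at u x0 n.+1)] in
  let c := config_at u x0 n in
  elapse (t - epoch c) (cstate c).

Inductive source :=
  | Initial
  | Arrival of nat
  | Service of 'I_k & nat
  | Dispatch of nat & {set 'I_k} & nat.

Section realization.
Context {d : measure_display} {W : measurableType d} (P : probability W R).

Definition mutually_independent (I : Type) (G : I -> set (set W)) : Prop :=
  forall (n : nat) (s : 'I_n -> I), injective s ->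
  forall E : 'I_n -> set W, (forall i, G (s i) (E i)) ->
    P (\bigcap_(i in [set: 'I_n]) E i) = (\big[*%E/1%E]_(i < n) P (E i)).

Definition sigma_of {d'} {V : measurableType d'} (X : W -> V) : set (set W) :=
  preimage_set_system setT X measurable.

Definition source_sigma (X0 : W -> state) (u : W -> inputs) (s : source) :
  set (set W) :=
  match s with
  | Initial => sigma_of X0
  | Arrival n => sigma_of (fun w => interarrival (u w) n)
  | Service i n => sigma_of (fun w => service (u w) i n)
  | Dispatch n A j => sigma_of (fun w => dispatch (u w) n A j)
  end.

(* The random inputs u have the prescribed laws and are mutually independent
   and independent of the initial state X0. *)
Definition queue_inputs (F0 : probability R R) (F : 'I_k -> probability R R)
    (D : {set 'I_k} -> nat -> {set 'I_k} -> R)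
    (X0 : W -> state) (u : W -> inputs) : Prop :=
  [/\ measurable_fun setT X0 /\ (forall w, valid_state (X0 w)),
      forall n,
        [/\ measurable_fun setT (fun w => interarrival (u w) n),
            forall w, 0 <= interarrival (u w) n
          & forall B : set R, measurable B ->
              P [set w | B (interarrival (u w) n)] = F0 B],
      forall i n,
        [/\ measurable_fun setT (fun w => service (u w) i n),
            forall w, 0 <= service (u w) i n
          & forall B : set R, measurable B ->
              P [set w | B (service (u w) i n)] = F i B],
      forall n A j,
        measurable_fun setT (fun w => dispatch (u w) n A j) /\
        (forall B, P [set w | dispatch (u w) n A j = B] = (D A j B)%:E)
    & mutually_independent (source_sigma X0 u)].

End realization.

(* pi is stationary: if the process is started from pi, then X(t) has law pi
   for all t >= 0. *)
Definition stationary (F0 : probability R R) (F : 'I_k -> probability R R)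
    (D : {set 'I_k} -> nat -> {set 'I_k} -> R)
    (pi : probability state R) : Prop :=
  exists (d : measure_display) (W : measurableType d) (P : probability W R)
    (X0 : W -> state) (u : W -> inputs),
  [/\ queue_inputs P F0 F D X0 u,
      forall B : set state, measurable B -> P [set w | B (X0 w)] = pi B
    & forall (t : R) (B : set state), 0 <= t -> measurable B ->
        P [set w | B (queue_path (u w) (X0 w) t)] = pi B].

End queue.
Arguments state : clear implicits.
Arguments inputs : clear implicits.
Arguments config : clear implicits.
Arguments source : clear implicits.

(* Main.v *)
Require Import Defs.
From mathcomp Require Import all_boot all_order all_algebra.
From mathcomp Require Import ring lra.
From mathcomp Require Import all_classical all_reals all_analysis.
From mathcomp Require Import measurable_realfun.

(* A heavy tail forces zeta_lim = 0, because E(exp(zeta_lim T)) <= exp(th) by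
   monotone convergence; hence the two suprema range over the same set. Jensen's
   inequality gives eta th <= - lam0 * th and zeta_lim (F i) th <= lam i * th.
   The latter is strict because a spread-out law is not a point mass; without
   strictness, deterministic times with rho = 1 would give alpha = +oo.
   Conversely, differentiating the moment generating functions at 0 gives
   eta th >= - (lam0 / q) * th and, for light tails,
   zeta_lim (F i) th >= q * lam i * th, for each q < 1 and small enough th > 0. *)

Set Implicit Arguments.
Unset Strict Implicit.
Unset Printing Implicit Defensive.

Import Order.TTheory GRing.Theory Num.Theory.
Import numFieldNormedType.Exports.

Local Open Scope classical_set_scope.
Local Open Scope ring_scope.

(** * Moment generating functions: Jensen, monotonicity, convexity, solvability *)

Section moment_generating_function.
Context d (T : measurableType d) (R : realType) (P : probability T R).
Implicit Types (Y : T -> R) (z w m c t s : R).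

Definition mgf Y z : \bar R := (\int[P]_x (expR (z * Y x))%:E)%E.

(** [g - f] is almost surely nonnegative with nonpositive integral, so it vanishes almost surely.
    The strict forms of Jensen's inequality and of monotonicity rest on this. *)
Lemma ae_eq_le_integral (f g : T -> R) :
  P.-integrable setT (EFin \o f) -> P.-integrable setT (EFin \o g) ->
  {ae P, forall x, f x <= g x} ->
  (\int[P]_x (g x)%:E <= \int[P]_x (f x)%:E)%E ->
  {ae P, forall x, f x = g x}.
Proof.
move=> fi gi fg gf.
have mf : measurable_fun setT f by apply/measurable_EFinP; exact: measurable_int fi.
have mg : measurable_fun setT g by apply/measurable_EFinP; exact: measurable_int gi.
have mh : measurable_fun setT (EFin \o (g \- f)).
  by apply/measurable_EFinP; exact: measurable_funB.
have : (\int[P]_x `|((g \- f)%R x)%:E| = 0)%E.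
  apply/eqP; rewrite eq_le integral_ge0 ?andbT; last by move=> x _; exact: abse_ge0.
  have -> : (\int[P]_x `|((g \- f)%R x)%:E| = \int[P]_x ((g x)%:E - (f x)%:E))%E.
    apply: ae_eq_integral => //; first exact: measurableT_comp.
    by apply: filterS fg => x fgx _ /=; rewrite ger0_norm ?subr_ge0.
  rewrite integralB//= leeBlDr ?add0e//.
  exact: integrable_fin_num.
move=> /(ae_eq_integral_abs _ measurableT mh); apply: filterS => x /(_ I).
by move=> /= -[] /eqP; rewrite subr_eq0 => /eqP.
Qed.

Lemma measurable_mgf Y z : measurable_fun setT Y ->
  measurable_fun setT (fun x => (expR (z * Y x))%:E).
Proof.
move=> mY; apply/measurable_EFinP; apply: (measurableT_comp (@measurable_expR R)).
exact: (measurable_funM (measurable_cst z) mY).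
Qed.

Lemma integrable_mgf Y z : measurable_fun setT Y -> (mgf Y z < +oo)%E ->
  P.-integrable setT (fun x => (expR (z * Y x))%:E).
Proof.
move=> mY Mz; apply/integrableP; split; first exact: measurable_mgf.
by under eq_integral do rewrite gee0_abs ?lee_fin ?expR_ge0//.
Qed.

Lemma mgf_le_cst Y z (K : R) : measurable_fun setT Y -> 0 <= K ->
  {ae P, forall x, expR (z * Y x) <= K} -> (mgf Y z <= K%:E)%E.
Proof.
move=> mY K0 YK; apply: (@le_trans _ _ (\int[P]_x cst K%:E x)%E).
  apply: ae_ge0_le_integral => //; first exact: measurable_mgf.
  by apply: filterS YK => x ? _; rewrite lee_fin.
by rewrite integral_cst//= probability_setT mule1.
Qed.

Lemma mgf0 Y : mgf Y 0 = 1%E.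
Proof.
rewrite /mgf; under eq_integral do rewrite mul0r expR0.
by rewrite (integral_cst P measurableT 1%E)/= probability_setT mule1.
Qed.

Lemma mgf_shift Y z m : measurable_fun setT Y ->
  mgf (fun x => Y x - m) z = ((expR (- (z * m)))%:E * mgf Y z)%E.
Proof.
move=> mY; rewrite -ge0_integralZl//.
- by apply: eq_integral => x _; rewrite -EFinM -expRD; congr (expR _)%:E; ring.
- exact: measurable_mgf.
Qed.

Lemma integrable_mgf_shift Y z m : measurable_fun setT Y -> (mgf Y z < +oo)%E ->
  P.-integrable setT (fun x => (expR (z * (Y x - m)))%:E).
Proof.
move=> mY Mz; apply: (@integrable_mgf (fun x => Y x - m)).
  exact: measurable_funB.
by rewrite mgf_shift// lte_mul_pinfty// lee_fin expR_ge0.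
Qed.

(** This is the minorant [1 + u <= expR u] at [u = z * (Y x - m)]; centering at the mean leaves only
    the constant 1. *)
Lemma integral_tangent Y z m : P.-integrable setT (EFin \o Y) ->
  (\int[P]_x (Y x)%:E = m%:E)%E ->
  P.-integrable setT (EFin \o (fun x => 1 + z * (Y x - m))) /\
  (\int[P]_x (1 + z * (Y x - m))%:E = 1)%E.
Proof.
move=> iY EY.
have i1 (c : R) : P.-integrable setT (EFin \o cst c).
  exact: finite_measure_integrable_cst.
have iZ : P.-integrable setT (fun x => z%:E * (Y x)%:E)%E.
  exact: integrableZl.
have E x : ((1 + z * (Y x - m))%:E = (EFin \o cst (1 - z * m)%R) x + z%:E * (Y x)%:E)%E.
  by rewrite /= -EFinM -EFinD; congr _%:E; ring.
split.
  by apply: (eq_integrable measurableT _ _ _ (integrableD measurableT (i1 _) iZ)) => x _; exact: esym (E x).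
under eq_integral do rewrite E.
rewrite (integralD measurableT (i1 _) iZ).
have -> : (\int[P]_x (EFin \o cst (1 - z * m)%R) x = (1 - z * m)%:E)%E.
  by rewrite [LHS](integral_cst P measurableT (1 - z * m)%:E)/= probability_setT mule1.
rewrite integralZl// EY.
by rewrite -EFinM -EFinD; congr _%:E; ring.
Qed.

(** Jensen's inequality: integrate the tangent below the exponential of the centered variable. *)
Lemma mgf_ge_expR_mean Y z m : P.-integrable setT (EFin \o Y) ->
  (\int[P]_x (Y x)%:E = m%:E)%E -> ((expR (z * m))%:E <= mgf Y z)%E.
Proof.
move=> iY EY.
have mY : measurable_fun setT Y by apply/measurable_EFinP; exact: measurable_int iY.
have [Mz|] := ltP (mgf Y z) +oo%E; last by rewrite leye_eq => /eqP ->; rewrite leey.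
have [i1 E1] := integral_tangent z iY EY.
have : (1 <= mgf (fun x => (Y x - m)%R) z)%E.
  rewrite -[leLHS]E1; apply: le_integral => //.
    exact: integrable_mgf_shift.
  by move=> x _; rewrite lee_fin expR_ge1Dx.
by rewrite mgf_shift// expRN lee_pdivlMl ?expR_gt0// mule1.
Qed.

(** Equality case of Jensen: tangent and exponential agree almost surely, and they touch only at
    [u = 0]. *)
Lemma mgf_le_expR_mean Y z m : P.-integrable setT (EFin \o Y) ->
  (\int[P]_x (Y x)%:E = m%:E)%E -> z != 0 -> (mgf Y z <= (expR (z * m))%:E)%E ->
  {ae P, forall x, Y x = m}.
Proof.
move=> iY EY z0 Mz.
have mY : measurable_fun setT Y by apply/measurable_EFinP; exact: measurable_int iY.
have [i1 E1] := integral_tangent z iY EY.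
have : {ae P, forall x, 1 + z * (Y x - m) = expR (z * (Y x - m))}.
  apply: ae_eq_le_integral => //.
  - by apply: integrable_mgf_shift => //; rewrite (le_lt_trans Mz)// ltry.
  - by apply: aeW => x; exact: expR_ge1Dx.
  - by rewrite [leRHS]E1 -/(mgf _ z) mgf_shift// expRN lee_pdivrMl ?expR_gt0// mule1.
apply: filterS => x; apply: contra_eq => Ym.
by rewrite lt_eqF// expR_gt1Dx// mulf_neq0// subr_eq0.
Qed.

(** If [w < z], then [expR (w * Y x) <= expR (z * Y x)] while the integrals are in the reverse
    order, so both agree almost surely and [Y] vanishes. Bounds on moments thereby become bounds on
    exponents. *)
Lemma mgf_le_inv Y z w : measurable_fun setT Y ->
  {ae P, forall x, 0 <= Y x} -> ~ {ae P, forall x, Y x = 0} ->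
  (mgf Y z <= mgf Y w)%E -> (mgf Y w < +oo)%E -> z <= w.
Proof.
move=> mY Y0 Yn0 zw Mw; rewrite leNgt; apply/negP => wz; apply: Yn0.
have : {ae P, forall x, expR (w * Y x) = expR (z * Y x)}.
  apply: ae_eq_le_integral => //.
  - exact: integrable_mgf.
  - by apply: integrable_mgf => //; exact: le_lt_trans Mw.
  - apply: filterS Y0 => x Yx; rewrite ler_expR ler_wpM2r//; exact: ltW.
apply: filterS => x /expR_inj/eqP; rewrite -subr_eq0 -mulrBl mulf_eq0 subr_eq0.
by rewrite (lt_eqF wz) => /eqP.
Qed.

(** The generating function of [Y - c] is convex with value 1 at 0, so a bound by 1 at [z] holds on
    the whole segment from 0 to [z]. *)
Lemma mgf_convex_le Y z c t : measurable_fun setT Y ->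
  (mgf Y z <= (expR (z * c))%:E)%E -> 0 <= t <= 1 ->
  (mgf Y (t * z) <= (expR (t * z * c))%:E)%E.
Proof.
move=> mY Mz t01.
suff : (mgf (fun x => (Y x - c)%R) (t * z)%R <= 1)%E.
  by rewrite mgf_shift// expRN lee_pdivrMl ?expR_gt0// mule1.
have {Mz} : (mgf (fun x => (Y x - c)%R) z <= 1)%E.
  by rewrite mgf_shift// expRN lee_pdivrMl ?expR_gt0// mule1.
have mexp s : measurable_fun setT (fun x => (expR (s * (Y x - c)))%:E).
  apply: (@measurable_mgf (fun x => Y x - c)); exact: measurable_funB.
move=> Mz; have /andP[t0 t1] := t01.
apply: (@le_trans _ _
  (\int[P]_x ((1 - t)%:E + t%:E * (expR (z * (Y x - c)))%:E))%E).
  apply: ge0_le_integral => //.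
  - apply: emeasurable_funD => //; exact: emeasurable_funM.
  - move=> x _; rewrite -EFinM -EFinD lee_fin.
    have : expR (t * (z * (Y x - c)) + (1 - t) * 0) <=
           t * expR (z * (Y x - c)) + (1 - t) * expR 0.
      exact: (convex_expR (Itv01 t0 t1)).
    by rewrite expR0 mulr1 mulr0 addr0 mulrA [leRHS]addrC.
rewrite ge0_integralD//; last 3 first.
- by move=> x _; rewrite lee_fin subr_ge0.
- by move=> x _; rewrite -EFinM lee_fin mulr_ge0// expR_ge0.
- exact: emeasurable_funM.
rewrite (integral_cst P measurableT (1 - t)%:E)/= probability_setT mule1.
rewrite ge0_integralZl//.
apply: (@le_trans _ _ ((1 - t)%:E + t%:E * 1)%E).
  by rewrite leeD2l// lee_wpmul2l// lee_fin.
by rewrite mule1 -EFinD subrK.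
Qed.

Lemma mgf_solution Y (a b K c : R) : measurable_fun setT Y -> a <= b -> 0 <= K ->
  (forall z, a <= z <= b -> {ae P, forall x, expR (z * Y x) <= K}) ->
  (mgf Y a <= c%:E <= mgf Y b)%E ->
  exists2 z, a <= z <= b & mgf Y z = c%:E.
Proof.
move=> mY ab K0 bK acb.
(* The cap at K leaves the integrand unchanged for z in [a, b] and makes it
   bounded on a neighborhood of this interval. *)
pose f z x := Num.min K (expR (z * Y x)).
have f0 z x : 0 <= f z x by rewrite le_min K0 expR_ge0.
have mf z : measurable_fun setT (f z).
  apply: measurable_minr => //.
  by apply/measurable_EFinP; exact: (measurable_mgf z mY).
have iK : P.-integrable setT (EFin \o cst K) by exact: finite_measure_integrable_cst.
have fi z : P.-integrable setT (EFin \o f z).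
  apply: le_integrable iK => //; first exact/measurable_EFinP.
  by move=> x _ /=; rewrite lee_fin !ger0_norm// ge_min lexx.
have fE z : a <= z <= b -> ((\int[P]_x f z x)%R)%:E = mgf Y z.
  move=> zab; rewrite /Rintegral fineK; last exact: (integrable_fin_num measurableT (fi z)).
  apply: ae_eq_integral => //.
  - by apply/measurable_EFinP; exact: mf.
  - exact: measurable_mgf.
  - by apply: filterS (bK _ zab) => x xK _; rewrite /f /= min_r.
have cf : {in `]a - 1, b + 1[%classic, continuous (fun z => \int[P]_x f z x)}.
  apply: (continuity_under_integral measurableT _ _ iK) => //.
  - apply: aeW => x _ z _; apply: (@continuous_min R R^o (cst K) (fun z => expR (z * Y x))).
      exact: cvg_cst.
    apply: (@continuous_comp _ _ _ (fun z => z * Y x) expR); last exact: continuous_expR.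
    exact: mulrr_continuous.
  - move=> z _; apply: aeW => x _.
    by rewrite ger0_norm// ge_min lexx.
have [] := @IVT R (fun z => \int[P]_x f z x) a b c ab.
- apply: continuous_in_subspaceT => z; rewrite inE/= in_itv/= => /andP[az zb].
  by apply: cf; rewrite inE/= in_itv/= ltrBlDr ltr_pwDr//= ltr_pwDr.
- have : \int[P]_x f a x <= c <= \int[P]_x f b x.
    by rewrite -!lee_fin !fE// lexx ab.
  by move=> /andP[ac cb]; rewrite ge_min ac/= le_max cb orbT.
- by move=> z; rewrite in_itv/= => zab <-; exists z; rewrite ?fE.
Qed.

(** By dominated convergence, with bound 1, the moment at [- n] tends to [P(Y = 0) = 0]. This
    supplies the left endpoint for solving the equation of [eta]. *)
Lemma mgf_opp_le Y (e : R) : measurable_fun setT Y -> {ae P, forall x, 0 < Y x} ->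
  0 < e -> exists2 b, 0 < b & (mgf Y (- b) <= e%:E)%E.
Proof.
move=> mY Y0 e0.
have iK : P.-integrable setT (EFin \o cst (1 : R)).
  exact: finite_measure_integrable_cst.
have [|||||_ _ H] := @dominated_convergence _ T R P setT measurableT
  (fun n x => (expR (- n%:R * Y x))%:E) (cst 0%E) (EFin \o cst (1 : R)) _ _ _ _ _.
- by move=> n; exact: measurable_mgf.
- exact: measurable_cst.
- apply: filterS Y0 => x Yx _.
  apply: cvg_EFin; first exact: nearW.
  under eq_fun => n do rewrite /= mulNr -mulrN expRM_natl.
  by apply: cvg_expr; rewrite ger0_norm ?expR_ge0// expR_lt1 oppr_lt0.
- exact: iK.
- apply: filterS Y0 => x Yx n _ /=.
  rewrite lee_fin ger0_norm ?expR_ge0// -[leRHS]expR0 ler_expR mulNr oppr_le0.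
  by rewrite mulr_ge0// ltW.
move: H; rewrite integral0 => /(fine_cvgP _ (0 : R))[Hfin /cvgr_le/(_ _ e0) He].
near \oo => n; exists n%:R.
  by rewrite ltr0n; near: n; exact: nbhs_infty_gt.
rewrite -[leLHS]fineK ?lee_fin; last by near: n; exact: Hfin.
by near: n; exact: He.
Unshelve. all: by end_near. Qed.

(** Difference quotient at 0 of [t |-> expR (t * y)], with step [1 / n.+1]. *)
Definition expR_slope n (y : R) := n.+1%:R * (expR (n.+1%:R^-1 * y) - 1).

(** The first two bounds dominate the quotients uniformly in [n]; the first and the third squeeze
    them to [y]. *)
Lemma expR_slope_bounds n (y : R) :
  [/\ y <= expR_slope n y, expR_slope n y <= expR y
    & expR_slope n y <= y * expR (n.+1%:R^-1 * y)].
Proof.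
rewrite /expR_slope -[X in X * (_ - _)]invrK.
have : 0 < n.+1%:R^-1 :> R by rewrite invr_gt0.
have : n.+1%:R^-1 <= 1 :> R by rewrite invf_le1 ?ler1n ?ltr0n.
move: n.+1%:R^-1 => t t1 t0; rewrite !ler_pdivrMl// ler_pdivlMl//; split.
- by rewrite lerBrDl expR_ge1Dx.
- have : expR (t * y + (1 - t) * 0) <= t * expR y + (1 - t) * expR 0.
    exact: (convex_expR (Itv01 (ltW t0) t1)).
  rewrite mulr0 addr0 expR0 mulr1; lra.
(* This is [1 - u <= expR (- u)] at [u = t * y], multiplied by [expR u]. *)
- have : expR (t * y) * (1 - t * y) <= 1.
    by rewrite -[leRHS](expRxMexpNx_1 (t * y)) ler_pM2l ?expR_gt0// expR_ge1Dx.
  lra.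
Qed.

Lemma norm_expR_slope_le n y : `|expR_slope n y| <= `|y| + expR y.
Proof.
have [y1 y2 _] := expR_slope_bounds n y.
have := ler_norm y; have := ler_norm (- y); have := expR_ge0 y.
by rewrite normrN ler_norml => *; apply/andP; split; lra.
Qed.

Lemma expR_slope_cvg y : expR_slope n y @[n --> \oo] --> y.
Proof.
apply: (@squeeze_cvgr _ _ _ _ (fun=> y) (fun n => y * expR (n.+1%:R^-1 * y))).
- by apply: nearW => n; have [-> _ ->] := expR_slope_bounds n y.
- exact: cvg_cst.
- rewrite -[X in _ --> X](_ : y * expR 0 = _); last by rewrite expR0 mulr1.
  apply: cvgMr; apply: continuous_cvg; first exact: continuous_expR.
  by rewrite -[X in _ --> X](mul0r y); apply: cvgMl; exact: cvg_harmonic.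
Qed.

(** * Derivative of the generating function at 0 *)

Section slope.
Variables (Y : T -> R) (s m : R).
Hypothesis iY : P.-integrable setT (EFin \o Y).
Hypothesis EY : (\int[P]_x (Y x)%:E = m%:E)%E.
Hypothesis Ms : (mgf Y s < +oo)%E.

Let mY : measurable_fun setT Y.
Proof. by apply/measurable_EFinP; exact: measurable_int iY. Qed.

Let isY : P.-integrable setT (fun x => s%:E * (Y x)%:E)%E.
Proof. exact: integrableZl. Qed.

Let mslope n : measurable_fun setT (fun x => (expR_slope n (s * Y x))%:E).
Proof.
apply/measurable_EFinP; apply: measurable_funM => //.
apply: measurable_funB => //; apply: measurableT_comp => //.
by apply: measurable_funM => //; exact: measurable_funM.
Qed.

Let ibound : P.-integrable setT
  (fun x => `|s%:E * (Y x)%:E| + (expR (s * Y x))%:E)%E.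
Proof.
by apply: integrableD => //; [exact: integrable_abse|exact: integrable_mgf].
Qed.

Let islope n : P.-integrable setT (fun x => (expR_slope n (s * Y x))%:E).
Proof.
apply: le_integrable ibound => // x _; rewrite -EFinM/= lee_fin.
by rewrite [leRHS]ger0_norm ?addr_ge0 ?expR_ge0// norm_expR_slope_le.
Qed.

(** Dominated convergence: [|s * Y| + expR (s * Y)] bounds every quotient and is integrable because
    the moment at [s] is finite. *)
Lemma integral_expR_slope_cvg :
  (\int[P]_x (expR_slope n (s * Y x))%:E)%E @[n --> \oo] --> (s * m)%:E.
Proof.
have [|||||_ _] := @dominated_convergence _ T R P setT measurableT
  (fun n x => (expR_slope n (s * Y x))%:E) (fun x => (s * Y x)%:E)
  (fun x => `|s%:E * (Y x)%:E| + (expR (s * Y x))%:E)%E _ _ _ _ _.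
- exact: mslope.
- by apply/measurable_EFinP; exact: measurable_funM.
- apply: aeW => x _; apply: cvg_EFin; first exact: nearW.
  exact: expR_slope_cvg.
- exact: ibound.
- apply: aeW => x n _; rewrite -EFinM/= -EFinD lee_fin.
  exact: norm_expR_slope_le.
rewrite (_ : (\int[P]_x (s * Y x)%:E)%E = (s * m)%:E)//.
by rewrite EFinM -EY -integralZl.
Qed.

Lemma mgf_expR_slope n : mgf Y (n.+1%:R^-1 * s) =
  (1 + n.+1%:R^-1%:E * \int[P]_x (expR_slope n (s * Y x))%:E)%E.
Proof.
have i1 : P.-integrable setT (EFin \o cst (1 : R)).
  exact: finite_measure_integrable_cst.
have iZ : P.-integrable setT (fun x => n.+1%:R^-1%:E * (expR_slope n (s * Y x))%:E)%E.
  exact: integrableZl.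
rewrite -integralZl//.
transitivity (\int[P]_x ((EFin \o cst 1%R) x +
    n.+1%:R^-1%:E * (expR_slope n (s * Y x))%:E))%E.
  apply: eq_integral => x _; rewrite /= -EFinM -EFinD /expR_slope mulKf//.
  by rewrite addrC subrK mulrA.
rewrite (integralD measurableT i1 iZ); congr (_ + _)%E.
by rewrite [LHS](integral_cst P measurableT 1%E)/= probability_setT mule1.
Qed.

(* The bound is reached at some s / n by differentiating at 0, then passed on
   to smaller exponents by convexity. *)
Lemma mgf_le_expR_near (c : R) : s * m < s * c ->
  \forall t \near 0^'+, (mgf Y (t * s) <= (expR (t * s * c))%:E)%E.
Proof.
move=> mc.
have [Hfin /cvgr_le/(_ _ mc) He] := (fine_cvgP _ _).1 integral_expR_slope_cvg.
have [n Mn] : exists n, (mgf Y (n.+1%:R^-1 * s) <= (expR (n.+1%:R^-1 * s * c))%:E)%E.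
  near \oo => n; exists n; rewrite mgf_expR_slope.
  rewrite -[X in (_ * X)%E]fineK; last by near: n; exact: Hfin.
  rewrite -EFinM -EFinD lee_fin (le_trans _ (expR_ge1Dx _))// lerD2l -mulrA.
  by rewrite ler_pM2l ?invr_gt0//; near: n; exact: He.
near=> t.
have -> : t * s = (t * n.+1%:R) * (n.+1%:R^-1 * s) by rewrite mulrA mulfK.
apply: mgf_convex_le => //; rewrite mulr_ge0//=.
rewrite -ler_pdivlMr// mul1r; near: t; apply: nbhs_right_le.
by rewrite invr_gt0.
Unshelve. all: by end_near. Qed.

End slope.

End moment_generating_function.

Lemma probability1_ae d (T : measurableType d) (R : realType)
    (P : probability T R) (A : set T) :
  measurable A -> P A = 1%E -> {ae P, forall x, A x}.
Proof.
move=> mA PA; exists (~` A); split => //; first exact: measurableC.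
by rewrite probability_setC// PA subee.
Qed.

Lemma near_right0_scale (R : realType) (a : R) (A : set R) : 0 < a ->
  (\forall t \near 0^'+, A t) -> \forall t \near 0^'+, A (a * t).
Proof.
move=> a0 [e /= e0 eA]; exists (e / a) => /=; first by rewrite divr_gt0.
move=> t /=; rewrite sub0r normrN => te t0; apply: eA => /=; last exact: mulr_gt0.
by rewrite sub0r normrN normrM (gtr0_norm a0) mulrC -ltr_pdivlMr.
Qed.

(** * Spread-out laws are not point masses *)

Section nondegenerate.
Context {R : realType}.
Implicit Types (F : probability R R) (m : R).

Lemma conv_pow_dirac F m : {ae F, forall x, x = m} ->
  forall n (A : set R), measurable A -> conv_pow F n A = \d_(m *+ n) A.
Proof.
move=> Fm; elim=> [|n IH] A mA; first by rewrite mulr0n.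
have mshift x : measurable [set y | A (x + y)].
  rewrite -[X in measurable X]setTI; apply: measurable_funD => //.
rewrite /=; under eq_integral do rewrite IH//.
transitivity (\int[F]_x (cst (\d_(m *+ n.+1)%R A)) x)%E.
  apply: ae_eq_integral => //.
  - rewrite (_ : (fun x => _) = EFin \o (\1_A \o (fun x => x + m *+ n))).
      apply/measurable_EFinP; apply: measurableT_comp => //.
      exact: measurable_funD.
    by apply/funext => x; rewrite /= diracE.
  - apply: filterS Fm => x -> _ /=; rewrite !diracE mulrS.
    by [].
by rewrite integral_cst//= probability_setT mule1.
Qed.

(** The convolution power would be the point mass at [m *+ n]. Its absolutely continuous part
    vanishes on this Lebesgue-null point, and on the complement because the whole power does. *)
Lemma spread_out_nondegenerate F m :
  spread_out F -> ~ {ae F, forall x, x = m}.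
Proof.
move=> [n _ [ac [sg [FE acl _ ac0]]]] /conv_pow_dirac Fm.
have acm : ac [set m *+ n] = 0%E.
  apply: ((null_content_dominatesP _ _).1 acl).
    exact: measurable_set1.
  exact: lebesgue_measure_set1.
have acC : ac (~` [set m *+ n]) = 0%E.
  have mC : measurable (~` [set m *+ n] : set R) by exact: measurableC.
  apply/eqP; rewrite eq_le measure_ge0 andbT.
  have <- : conv_pow F n (~` [set m *+ n]) = 0%E.
    by rewrite Fm// diracE memNset//=; apply.
  by rewrite FE// leeDl.
have m1 : measurable ([set m *+ n] : set (measurableTypeR R)).
  exact: measurable_set1.
have := null_set_setU m1 (measurableC m1) acm acC.
by rewrite setUv => /eqP; rewrite (negbTE ac0).
Qed.

End nondegenerate.

Lemma nneg_ae (R : realType) (F : probability R R) :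
  F [set x | 0 <= x] = 1%E -> {ae F, forall x, 0 <= x}.
Proof.
move=> F1; apply: (probability1_ae _ F1).
by rewrite -set_itvcy; exact: measurable_itv.
Qed.

Lemma integrable_mean (R : realType) (F : probability R R) (m : R) :
  {ae F, forall x, 0 <= x} -> (\int[F]_x x%:E = m%:E)%E ->
  F.-integrable setT (EFin \o id).
Proof.
move=> F0 Fm; apply/integrableP; split; first by apply/measurable_EFinP.
rewrite (_ : (\int[F]_x _)%E = m%:E) ?ltry// -Fm.
apply: ae_eq_integral => //.
  apply: (@measurableT_comp _ _ _ _ _ _ abse _ (EFin \o id)) => //.
  exact/measurable_EFinP.
by apply: filterS F0 => x x0 _; rewrite /= ger0_norm.
Qed.

Lemma ae_eq0_mean (R : realType) (F : probability R R) (m : R) :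
  (\int[F]_x x%:E = m%:E)%E -> 0 < m -> ~ {ae F, forall x, x = 0}.
Proof.
move=> Fm m0 F0; move: m0; rewrite -lte_fin -Fm.
rewrite (_ : (\int[F]_x _)%E = 0%E) ?ltxx// -[RHS](integral0 F setT).
apply: ae_eq_integral => //.
by apply: filterS F0 => x -> _.
Qed.

(** * Linear bounds on [eta] *)

Section arrival.
Context {R : realType} (F : probability R R) (lam : R).
Hypothesis F_nneg : F [set x | 0 <= x] = 1%E.
Hypothesis F_at0 : F [set 0] = 0%E.
Hypothesis lam_gt0 : 0 < lam.
Hypothesis F_mean : (\int[F]_x x%:E = lam^-1%:E)%E.

Let F_ge0 : {ae F, forall x, 0 <= x}.
Proof. exact: nneg_ae. Qed.

Let F_gt0 : {ae F, forall x, 0 < x}.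
Proof.
have : {ae F, forall x, x != 0}.
  exists [set 0]; split => // x /=.
  by move=> /negP; rewrite negbK => /eqP.
by apply: filterS2 F_ge0 => x x0 xn0; rewrite lt_def xn0.
Qed.

Let iF := integrable_mean F_ge0 F_mean.

(** The intermediate value theorem on [[- b, 0]], where the integrand is at most 1, yields a
    solution; hence [xget] does not fall back on its default 0. *)
Lemma exp_moment_eta th : 0 <= th -> exp_moment F (eta F th) = (expR (- th))%:E.
Proof.
move=> th0.
have [b b0 Mb] := mgf_opp_le (@measurable_id _ _ setT) F_gt0 (expR_gt0 (- th)).
have [|||z _ Mz] := @mgf_solution _ _ _ F id (- b) 0 1 (expR (- th))
  (@measurable_id _ _ setT) _ ler01.
- by rewrite oppr_le0 ltW.
- move=> z /andP[_ z0]; apply: filterS F_ge0 => x x0.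
  by rewrite -[leRHS]expR0 ler_expR mulr_le0_ge0.
- by rewrite Mb mgf0 lee_fin -[leRHS]expR0 ler_expR oppr_le0.
have /= : ((expR th)%:E * exp_moment F (eta F th) = 1)%E.
  apply: (@xgetPex _ 0 [set z | ((expR th)%:E * exp_moment F z = 1)%E]).
  exists z => /=; rewrite [exp_moment _ _]Mz -EFinM.
  by rewrite expRxMexpNx_1.
move=> /(congr1 (fun u => (expR (- th))%:E * u)%E).
by rewrite mule1 muleA -EFinM -expRD addNr expR0 mul1e.
Qed.

Lemma eta_le th : 0 <= th -> eta F th <= - (lam * th).
Proof.
move=> th0; have := mgf_ge_expR_mean (eta F th) iF F_mean.
rewrite [leRHS]exp_moment_eta// lee_fin ler_expR ler_pdivrMr// => h.
by rewrite mulrC -mulNr.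
Qed.

Lemma eta_ge_near q : 0 < q < 1 ->
  \forall th \near 0^'+, - (lam / q * th) <= eta F th.
Proof.
move=> /andP[q0 q1].
have FN1 : (mgf F id (- 1) < +oo)%E.
  apply: le_lt_trans (ltry 1); apply: mgf_le_cst => //.
  apply: filterS F_ge0 => x x0.
  by rewrite -[leRHS]expR0 ler_expR mulN1r oppr_le0.
(* [q / lam] is below the mean, so the direction [- 1] gives [s * m < s * c]. Scaling by [lam / q]
   then makes the bound [expR (- th)], the moment at [eta]. *)
have := @mgf_le_expR_near _ _ _ F id (- 1) lam^-1 iF F_mean FN1 (q / lam).
have lq : 0 < lam / q by exact: divr_gt0.
rewrite !mulN1r ltrN2 ltr_pdivrMr// mulVf ?gt_eqF// => /(_ q1).
move=> /(near_right0_scale lq) H; near=> th.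
apply: (@mgf_le_inv _ _ _ F id) => //.
- by apply: ae_eq0_mean F_mean _; rewrite invr_gt0.
- rewrite [leRHS]exp_moment_eta//.
  rewrite (_ : - th = lam / q * th * -1 * (q / lam)).
    by rewrite -[- (lam / q * th)]mulrN1; near: th; exact: H.
  by field; rewrite ?gt_eqF.
- by rewrite [ltLHS]exp_moment_eta// ltry.
Unshelve. all: by end_near. Qed.

End arrival.

(** * Truncated exponents [zeta] and their limit *)

Section service.
Context {R : realType} (F : probability R R) (lam : R).
Implicit Types v w z th q : R.
Hypothesis F_nneg : F [set x | 0 <= x] = 1%E.
Hypothesis lam_gt0 : 0 < lam.
Hypothesis F_mean : (\int[F]_x x%:E = lam^-1%:E)%E.

Let F_ge0 : {ae F, forall x, 0 <= x}.
Proof. exact: nneg_ae. Qed.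

Let iF := integrable_mean F_ge0 F_mean.

Let F_neq0 : ~ {ae F, forall x, x = 0}.
Proof. by apply: ae_eq0_mean F_mean _; rewrite invr_gt0. Qed.

Let mmin (v : R) : measurable_fun setT (fun x : R => Num.min x v).
Proof. exact: measurable_minr. Qed.

Let min_ge0 (v : R) : 0 < v -> {ae F, forall x, 0 <= Num.min x v}.
Proof. by move=> /ltW v0; apply: filterS F_ge0 => x x0; rewrite le_min x0. Qed.

Let min_neq0 (v : R) : 0 < v -> ~ {ae F, forall x, Num.min x v = 0}.
Proof.
move=> v0 m0; apply: F_neq0; apply: filterS m0 => x.
by case: ltP => // _ v00; rewrite v00 ltxx in v0.
Qed.

Let integrable_min (v : R) : 0 < v ->
  F.-integrable setT (EFin \o (fun x => Num.min x v)).
Proof.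
move=> v0; have iv : F.-integrable setT (fun x => `|x%:E| + v%:E)%E.
  apply: integrableD => //; first exact: integrable_abse iF.
  exact: (finite_measure_integrable_cst F v).
apply: le_integrable iv => //; first by apply/measurable_EFinP.
move=> x _; rewrite /= lee_fin [leRHS]ger0_norm ?addr_ge0 ?(ltW v0)//.
have := ler_norm x; have := ler_norm (- x); rewrite normrN ler_norml.
have := normr_ge0 x.
by case: (ltP x v) => *; apply/andP; split; lra.
Qed.

(** A solution exists in [[0, th / m]], [m] being the mean of the truncated time: by Jensen the
    moment at [th / m] is at least [expR th], and truncation bounds the integrand. *)
Lemma trunc_exp_moment_zeta v th : 0 < v -> 0 <= th ->
  trunc_exp_moment F v (zeta F v th) = (expR th)%:E.
Proof.
move=> v0 th0; have iv := integrable_min v0.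
pose m := \int[F]_x Num.min x v.
have mE : (\int[F]_x (Num.min x v)%:E = m%:E)%E.
  by rewrite fineK//; exact: (integrable_fin_num measurableT iv).
have m0 : 0 < m.
  rewrite ltNge; apply/negP => m0; apply: (min_neq0 v0).
  have : {ae F, forall x, cst 0 x = Num.min x v}.
    apply: ae_eq_le_integral => //; first exact: integrable0.
      exact: min_ge0.
    by rewrite mE integral0 lee_fin.
  by apply: filterS => x <-.
have [||||z _ Mz] := @mgf_solution _ _ _ F (fun x => Num.min x v) 0 (th / m)
  (expR (th / m * v)) (expR th) (mmin v) _ _ _ _.
- by rewrite divr_ge0// ltW.
- exact: expR_ge0.
- move=> z /andP[z0 zb]; apply: filterS (min_ge0 v0) => x x0.
  rewrite ler_expR (le_trans (ler_wpM2r x0 zb))// ler_wpM2l ?ge_min ?lexx ?orbT//.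
  exact: le_trans zb.
- rewrite mgf0 lee_fin -[leLHS]expR0 ler_expR th0/=.
  by rewrite (le_trans _ (mgf_ge_expR_mean _ iv mE))// lee_fin divfK// gt_eqF.
have /= : ((expR (- th))%:E * trunc_exp_moment F v (zeta F v th) = 1)%E.
  apply: (@xgetPex _ 0 [set z | ((expR (- th))%:E * trunc_exp_moment F v z = 1)%E]).
  exists z => /=; rewrite [trunc_exp_moment _ _ _]Mz -EFinM mulrC.
  by rewrite expRxMexpNx_1.
move=> /(congr1 (fun u => (expR th)%:E * u)%E).
by rewrite mule1 muleA -EFinM -expRD addrN expR0 mul1e.
Qed.

Lemma zeta_ge v z th : 0 < v -> 0 <= th ->
  (trunc_exp_moment F v z <= (expR th)%:E)%E -> z <= zeta F v th.
Proof.
move=> v0 th0 Mz; have MZ := trunc_exp_moment_zeta v0 th0.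
apply: (@mgf_le_inv _ _ _ F (fun x => Num.min x v)) => //.
- exact: min_ge0.
- exact: min_neq0.
- by rewrite [leRHS]MZ.
- by rewrite [ltLHS]MZ ltry.
Qed.

Lemma zeta_ge0 v th : 0 < v -> 0 <= th -> 0 <= zeta F v th.
Proof.
move=> v0 th0; apply: zeta_ge => //.
by rewrite [leLHS]mgf0 lee_fin -[leLHS]expR0 ler_expR.
Qed.

(** A higher truncation level raises the moment at a nonnegative exponent, which pushes the solution
    down. *)
Lemma zeta_nonincreasing v w th : 0 < v -> v <= w -> 0 <= th ->
  zeta F w th <= zeta F v th.
Proof.
move=> v0 vw th0; have w0 := lt_le_trans v0 vw.
apply: zeta_ge => //; rewrite -(trunc_exp_moment_zeta w0 th0).
apply: ge0_le_integral => //; try exact: measurable_mgf.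
move=> x _; rewrite lee_fin ler_expR ler_wpM2l ?zeta_ge0//.
by rewrite le_min !ge_min lexx vw orbT.
Qed.

Lemma zeta_cvg th : 0 <= th ->
  zeta F v th @[v --> +oo] --> zeta_lim F th.
Proof.
(* The maximum keeps the level positive, so that [f] is monotone on the whole line; only levels
   above 1 matter for the limit. *)
move=> th0; pose f v := - zeta F (Num.max 1 v) th.
have max0 (v : R) : 0 < Num.max 1 v by rewrite lt_max ltr01.
have : f v @[v --> +oo] --> sup (range f).
  apply: nondecreasing_cvgr.
    move=> v w vw; rewrite lerN2; apply: zeta_nonincreasing => //.
    by rewrite ge_max !le_max lexx vw orbT.
  by exists 0 => _ [v _ <-]; rewrite oppr_le0 zeta_ge0.
move=> /cvgN cf; apply/cvg_ex; exists (- sup (range f)).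
apply: cvg_trans cf; apply: near_eq_cvg; near=> v.
rewrite /f opprK max_r//; near: v; exact: nbhs_pinfty_ge.
Unshelve. all: by end_near. Qed.

Lemma zeta_lim_ge z th : 0 <= z -> 0 <= th ->
  (exp_moment F z <= (expR th)%:E)%E -> z <= zeta_lim F th.
Proof.
move=> z0 th0 Mz; apply: (cvgr_to_ge (zeta_cvg th0)).
near=> v; apply: zeta_ge => //; apply: le_trans Mz.
apply: ge0_le_integral => //; try exact: measurable_mgf.
by move=> x _; rewrite lee_fin ler_expR ler_wpM2l// ge_min lexx.
Unshelve. all: by end_near. Qed.

Lemma zeta_lim_ge0 th : 0 <= th -> 0 <= zeta_lim F th.
Proof.
move=> th0; apply: zeta_lim_ge => //.
by rewrite [leLHS]mgf0 lee_fin -[leLHS]expR0 ler_expR.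
Qed.

Lemma zeta_lim_le v th : 0 < v -> 0 <= th -> zeta_lim F th <= zeta F v th.
Proof.
move=> v0 th0; apply: (cvgr_to_le (zeta_cvg th0)).
near=> w; apply: zeta_nonincreasing => //; near: w; exact: nbhs_pinfty_ge.
Unshelve. all: by end_near. Qed.

(** With the exponent fixed at [zeta_lim], which is below every [zeta F v th], each truncated moment
    is at most [expR th]. Only an inequality survives in the limit: for a heavy tail and [th > 0] it
    is strict. *)
Lemma exp_moment_zeta_lim th : 0 <= th ->
  (exp_moment F (zeta_lim F th) <= (expR th)%:E)%E.
Proof.
move=> th0; set z := zeta_lim F th; have z0 : 0 <= z := zeta_lim_ge0 th0.
have cM : trunc_exp_moment F n.+1%:R z @[n --> \oo] --> exp_moment F z.
  have <- : (\int[F]_x limn (fun n => (expR (z * Num.min x n.+1%:R))%:E) =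
             exp_moment F z)%E.
    apply: eq_integral => x _; apply/cvg_lim => //; apply: cvg_near_cst.
    (* For fixed [x] the truncation is inactive once [n >= x]. *)
    near=> n; rewrite min_l// (@le_trans _ _ n%:R) ?ler_nat//.
    by near: n; exact: nbhs_infty_ger.
  apply: cvg_monotone_convergence => //.
  - by move=> n; exact: measurable_mgf.
  - move=> x _ n p np; rewrite lee_fin ler_expR ler_wpM2l// le_min !ge_min lexx/=.
    by rewrite ler_nat ltnS np orbT.
apply: (cvge_to_le cM); apply: nearW => n.
rewrite -(trunc_exp_moment_zeta (ltr0Sn R n) th0).
apply: ae_ge0_le_integral => //; try exact: measurable_mgf.
apply: filterS (min_ge0 (ltr0Sn R n)) => x x0 _.
by rewrite lee_fin ler_expR ler_wpM2r// zeta_lim_le.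
Unshelve. all: by end_near. Qed.

(** Otherwise the moment at [zeta_lim] is at most [expR (zeta_lim / lam)], the equality case of
    Jensen, and the law is a point mass. *)
Lemma zeta_lim_lt th : spread_out F -> 0 < th -> zeta_lim F th < lam * th.
Proof.
move=> sF th0; rewrite ltNge; apply/negP => lz.
have z0 : 0 < zeta_lim F th by apply: lt_le_trans lz; exact: mulr_gt0.
apply: (spread_out_nondegenerate (m := lam^-1) sF).
apply: (mgf_le_expR_mean iF F_mean (lt0r_neq0 z0)).
rewrite (le_trans (exp_moment_zeta_lim (ltW th0)))// lee_fin ler_expR.
by rewrite ler_pdivlMr// mulrC.
Qed.

(** The moment at [zeta_lim] is finite, so [zeta_lim] cannot exceed the abscissa. *)
Lemma zeta_lim_heavy th : 0 <= th -> exp_abscissa F = 0%E -> zeta_lim F th = 0.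
Proof.
move=> th0 F0; apply/eqP; rewrite eq_le zeta_lim_ge0// andbT.
suff : ((zeta_lim F th)%:E <= exp_abscissa F)%E by rewrite F0 lee_fin.
apply: ereal_sup_ubound; exists (zeta_lim F th) => //=.
by rewrite (le_lt_trans (exp_moment_zeta_lim th0))// ltry.
Qed.

Lemma zeta_lim_ge_near q : exp_abscissa F != 0%E -> 0 < q < 1 ->
  \forall th \near 0^'+, q * lam * th <= zeta_lim F th.
Proof.
move=> Fn0 /andP[q0 q1].
(* The abscissa is at least 0 because the moment at 0 is 1; being nonzero, it is positive. *)
have [s s0 Ms] : exists2 s, 0 < s & (mgf F id s < +oo)%E.
  have : (0 < exp_abscissa F)%E.
    rewrite lt_def Fn0; apply: ereal_sup_ubound; exists 0 => //=.
    by rewrite [ltLHS](mgf0 F id) ltry.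
  by move=> /ereal_sup_gt[_ [s /= Ms <-] s0]; exists s.
(* [(q * lam)^-1] exceeds the mean; at exponent [q * lam * th] the resulting bound is exactly
   [expR th]. *)
have := @mgf_le_expR_near _ _ _ F id s lam^-1 iF F_mean Ms (q * lam)^-1.
have ql : 0 < q * lam by exact: mulr_gt0.
rewrite ltr_pM2l// ltf_pV2 ?posrE// gtr_pMl// => /(_ q1).
have qls : 0 < q * lam / s by exact: divr_gt0.
move=> /(near_right0_scale qls) H; near=> th.
apply: zeta_lim_ge; [by rewrite mulr_ge0// ltW|by []|].
have -> : q * lam * th = q * lam / s * th * s by field; rewrite ?gt_eqF.
have {2}-> : th = q * lam / s * th * s * (q * lam)^-1 by field; rewrite ?gt_eqF.
by near: th; exact: H.
Unshelve. all: by end_near. Qed.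

End service.

(** * Removal of heavy-tailed servers and the criterion for a positive supremum *)

Theorem corollary3p1 (R : realType) (k : nat)
    (F0 : probability R R) (F : 'I_k -> probability R R)
    (lam0 : R) (lam : 'I_k -> R)
    (D : {set 'I_k} -> nat -> {set 'I_k} -> R)
    (k_ge1 : (1 <= k)%N)
    (F0_nneg : F0 [set x | 0 <= x] = 1%E)
    (F_nneg : forall i, F i [set x | 0 <= x] = 1%E)
    (lam0_gt0 : 0 < lam0)
    (lam_gt0 : forall i, 0 < lam i)
    (F0_mean : (\int[F0]_x x%:E = lam0^-1%:E)%E)
    (F_mean : forall i, (\int[F i]_x x%:E = (lam i)^-1%:E)%E)
    (D_rule : dispatch_rule D)
    (F0_pos : (0 < F0 [set x | (0 < x)%R])%E)
    (F_pos : forall i, (0 < F i [set x | (0 < x)%R])%E)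
    (F0_at0 : F0 [set 0] = 0%E)
    (X_stationary : exists pi : probability (state R k) R,
       stationary F0 F D pi)
    (F_spread_out : forall i, spread_out (F i))
    (stable : lam0 < \sum_(i < k) lam i) :
  alpha F0 F finset.setT = alpha F0 F (~: heavy_tailed F)%SET /\
  ((0 < alpha F0 F finset.setT)%E <->
   (rho lam0 lam (~: heavy_tailed F)%SET < 1)%E).
Proof.
have mE0 th : 0 <= th ->
    \sum_(i in finset.setT) zeta_lim (F i) th =
    \sum_(i in (~: heavy_tailed F)%SET) zeta_lim (F i) th.
  move=> th0; rewrite [LHS](bigID (mem (~: heavy_tailed F)%SET))/=.
  rewrite [X in _ + X]big1 ?addr0; last first.
    move=> i /andP[_]; rewrite !inE negbK => /eqP.
    exact: (zeta_lim_heavy (F_nneg i) (lam_gt0 i) (F_mean i)).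
  by apply: eq_bigl => i; rewrite inE.
have alphaE : alpha F0 F finset.setT = alpha F0 F (~: heavy_tailed F)%SET.
  congr (ereal_sup (image _ _)); apply/seteqP.
  by split=> th /= [th0]; rewrite mE0.
split => //; rewrite alphaE; set A := (~: heavy_tailed F)%SET.
(* For empty [A] both sides are false: [rho] is [+oo] and the sum is 0. *)
have rhoE : (rho lam0 lam A < 1)%E = (lam0 < \sum_(i in A) lam i).
  rewrite /rho; have [->|/set0Pn[i iA]] := eqVneq A finset.set0.
    by rewrite big_set0 ltNge leey/=; apply/esym/negbTE; rewrite -leNgt ltW.
  rewrite lte_fin ltr_pdivrMr ?mul1r//.
  by rewrite (bigD1 i)//= ltr_wpDr// sumr_ge0// => j _; exact: ltW.
rewrite rhoE; split => [/ereal_sup_gt[_ [th [th0 g0] <-]]|lamA].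
- rewrite lte_fin oppr_le0 in g0 * => {}th0.
  have := eta_le F0_nneg F0_at0 lam0_gt0 F0_mean (ltW th0).
  (* Without any light-tailed server no strict service bound is available, but then [eta >= 0]
     contradicts [eta <= - lam0 * th < 0]. *)
  have [A0|/set0Pn[i iA]] := eqVneq A finset.set0.
    move: g0; rewrite A0 big_set0 addr0 => /le_trans h /h.
    by rewrite oppr_ge0 leNgt mulr_gt0.
  rewrite -(ltr_pM2r th0) => etath.
  apply: (@le_lt_trans _ _ (\sum_(i in A) zeta_lim (F i) th)); first by lra.
  rewrite mulr_suml (bigD1 i)//= [ltRHS](bigD1 i)//=.
  (* Strictness is used for server [i]; weak bounds suffice for the others. *)
  by apply: ltr_leD => [|]; last apply: ler_sum => j _; try apply: ltW;
    exact: (zeta_lim_lt (F_nneg _) (lam_gt0 _) (F_mean _)).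
- set S := \sum_(i in A) lam i in lamA.
  have S0 : 0 < S := lt_trans lam0_gt0 lamA.
  (* The loss [q] enters once through [eta] and once through [zeta_lim], so [x <= q ^ 2] is
     required; for the midpoint of [x] and 1 this is [0 <= (1 - x) ^ 2]. *)
  pose x := lam0 / S; pose q := (1 + x) / 2.
  have x0 : 0 < x by exact: divr_gt0.
  have x1 : x < 1 by rewrite ltr_pdivrMr// mul1r.
  have q01 : 0 < q < 1 by rewrite /q; apply/andP; split; lra.
  have q0 : 0 < q by case/andP: q01.
  have qS : lam0 / q <= q * S.
    rewrite ler_pdivrMr// -[leLHS](divfK (lt0r_neq0 S0)) -/x.
    rewrite [leRHS]mulrAC ler_pM2r// /q.
    have := sqr_ge0 (1 - x); rewrite !expr2; lra.
  have Heta := eta_ge_near F0_nneg F0_at0 lam0_gt0 F0_mean q01.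
  have Hzeta : \forall th \near 0^'+,
      forall i, i \in A -> q * lam i * th <= zeta_lim (F i) th.
    (* There are finitely many servers, so one neighborhood serves them all; heavy-tailed ones
       satisfy the implication vacuously. *)
    apply: filter_forall => i; rewrite /A !inE.
    have [hi|hi] := boolP (exp_abscissa (F i) == 0%E); first exact: nearW.
    have := zeta_lim_ge_near (F_nneg i) (lam_gt0 i) (F_mean i) hi q01.
    by apply: filterS.
  near (0:R)^'+ => th.
  have th0 : 0 < th by [].
  (* A single positive [th] in the set bounds the supremum away from 0. *)
  apply: (@lt_le_trans _ _ th%:E); first by rewrite lte_fin.
  apply: ereal_sup_ubound; exists th => //=; split; first exact: ltW.
  rewrite oppr_le0.
  have h1 : - (lam0 / q * th) <= eta F0 th by near: th.
  have h2 : q * S * th <= \sum_(i in A) zeta_lim (F i) th.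
    rewrite /S mulr_sumr mulr_suml; apply: ler_sum => i iA.
    by move: i iA; near: th.
  have : lam0 / q * th <= q * S * th by rewrite ler_pM2r.
  by lra.
Unshelve. all: by end_near. Qed.
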